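(* Let $X\neq\{0\}$ be a finite-dimensional Banach space over $\mathbb{F}$ ($\mathbb{F}=\mathbb{R}$ or $\mathbb{C}$) such that the numerical radius $w(\cdot)$ is a norm on $L(X)$. Then $$E_{B_{L(X)_w^*}}=\{x^*\otimes x: x^*\in E_{B_{X^*}},\ x\in E_{B_X},\ |x^*(x)|=1\}.$$
   Context: For a normed space $Z$ over $\mathbb{F}$, $B_Z$ and $S_Z$ denote the closed unit ball and unit sphere, $Z^*$ the topological dual, and $E_C$ the set of extreme points of a convex set $C$. $L(X)$ is the space of bounded linear operators $X\to X$. For $T\in L(X)$ the numerical radius is $w(T)=\sup\{|x^*(Tx)|: x^*\in S_{X^*}, x\in S_X, x^*(x)=1\}$. $L(X)_w$ denotes the vector space $L(X)$ normed by $w(\cdot)$, and $L(X)_w^*$ its dual, with the dual norm. For $x\in X$, $x^*\in X^*$, $x^*\otimes x$ denotes the linear functional on $L(X)_w$ given by $[x^*\otimes x](T)=x^*(Tx)$. *)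

(* Defs.v *)
(* The scalar field is a numFieldType K and norms take their
   values in K, as for normedModType K; when K = R[i], an inequality between
   elements of K says that their difference is real and nonnegative. *)
From HB Require Import structures.
From mathcomp Require Import all_boot all_order all_algebra.
From mathcomp Require Import complex.
From mathcomp Require Import boolp classical_sets functions reals topology.
From mathcomp Require Import normedtype.

Set Implicit Arguments.
Unset Strict Implicit.
Unset Printing Implicit Defensive.

Import Order.TTheory GRing.Theory Num.Theory.
Import numFieldNormedType.Exports.

Local Open Scope classical_set_scope.
Local Open Scope ring_scope.

Inductive real_or_complex : numFieldType -> Prop :=
| Real_field (R : realType) : real_or_complex R
| Complex_field (R : realType) : real_or_complex R[i].

Definition finite_dimensional (K : numFieldType) (V : lmodType K) : Prop :=
  exists (n : nat) (e : 'I_n -> V),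
    forall x : V, exists c : 'I_n -> K, x = \sum_(i < n) c i *: e i.

Definition extreme_points (K : numFieldType) (V : lmodType K) (C : set V) :
    set V :=
  [set x | C x /\ forall (y z : V) (t : K), C y -> C z -> 0 < t -> t < 1 ->
           x = t *: y + (1 - t) *: z -> y = x /\ z = x].

Definition is_norm (K : numFieldType) (V : lmodType K) (N : V -> K) : Prop :=
  [/\ forall v, 0 <= N v,
      forall v, N v = 0 -> v = 0,
      forall (a : K) v, N (a *: v) = `|a| * N v
    & forall u v, N (u + v) <= N u + N v].

Section Dual.
Variables (K : numFieldType) (Z : normedModType K).

Definition unit_ball : set Z := [set z | `|z| <= 1].

Definition unit_sphere : set Z := [set z | `|z| = 1].

(* Subsets of the K-vector space Z -> K^o of all functions. *)
Definition dual : set (Z -> K^o) := [set f | linear f /\ continuous f].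

(* supremum is relative to the order of K. For K = R[i] every upper bound of a
   nonempty set of real numbers is real, so it is the supremum in R. *)
Definition dual_norm (f : Z -> K^o) : K :=
  supremum 0 [set `|f z| | z in unit_ball].

Definition dual_ball : set (Z -> K^o) := [set f | dual f /\ dual_norm f <= 1].

Definition dual_sphere : set (Z -> K^o) := [set f | dual f /\ dual_norm f = 1].

End Dual.

Section BoundedOperators.
Variables (K : numFieldType) (X : normedModType K).

Definition bounded_linear : {pred X -> X} := fun T =>
  `[< linear T /\ exists M : K, forall x, `|T x| <= M * `|x| >].

Lemma bounded_linear_submod_closed : submod_closed bounded_linear.
Proof.
split=> [|a f g /asboolP[lf [M fM]] /asboolP[lg [N gN]]]; apply/asboolP; split.
- by move=> b x y; rewrite /= scaler0 addr0.
- by exists 0 => x; rewrite /= normr0 mul0r.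
- move=> b x y; rewrite !fctE lf lg !scalerDr !scalerA [a * b]mulrC.
  by rewrite addrACA.
- exists (`|a| * M + N) => x.
  rewrite (le_trans (ler_normD _ _))// mulrDl lerD ?gN//.
  by rewrite normrZ -mulrA ler_wpM2l.
Qed.

HB.instance Definition _ := GRing.isSubmodClosed.Build K (X -> X)
  bounded_linear bounded_linear_submod_closed.

Record bounded_operator : Type := BoundedOperator {
  operator_fun :> X -> X;
  _ : operator_fun \in bounded_linear }.

HB.instance Definition _ := [isSub for operator_fun].
HB.instance Definition _ := [Choice of bounded_operator by <:].
HB.instance Definition _ := [SubChoice_isSubLmodule of bounded_operator by <:].

Definition numerical_radius (T : bounded_operator) : K :=
  supremum 0 [set r | exists (xs : X -> K^o) (x : X),
    [/\ dual_sphere xs, unit_sphere x, xs x = 1 & r = `|xs (T x)|]].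

(* The space bounded_operator with the norm numerical_radius; the normed
   module structure needs the proof w_norm, hence this dependent alias. *)
Definition operator_w (w_norm : is_norm numerical_radius) : Type :=
  bounded_operator.

Section OperatorW.
Variable w_norm : is_norm numerical_radius.

Let w_triangle : forall S T, numerical_radius (S + T) <=
  numerical_radius S + numerical_radius T.
Proof. by case: w_norm. Qed.

Let w_scale : forall (a : K) T,
  numerical_radius (a *: T) = `|a| * numerical_radius T.
Proof. by case: w_norm. Qed.

Let w_eq0 : forall T, numerical_radius T = 0 -> T = 0.
Proof. by case: w_norm. Qed.

HB.instance Definition _ := GRing.Lmodule.on (operator_w w_norm).
HB.instance Definition _ := Lmodule_isNormed.Build K (operator_w w_norm)
  w_triangle w_scale w_eq0.

Definition tensor (xs : X -> K^o) (x : X) : operator_w w_norm -> K^o :=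
  fun T => xs ((T : bounded_operator) x).

End OperatorW.

End BoundedOperators.

Arguments dual {K} Z.
Arguments dual_ball {K} Z.
Arguments unit_ball {K} Z.
Arguments numerical_radius {K X} T.
Arguments tensor {K X} w_norm xs x.

(* Main.v *)
(* The unit ball of the dual of L(X)_w is the convex hull of the set S of
   functionals g (x) x with g and x in the unit balls and |g(x)| = 1: S is
   compact and closed under multiplication by unimodular scalars, and w(T) is
   the supremum of |s(T)| over s in S, so a functional outside the hull would be
   strictly separated from S by some operator T. Hence extreme points lie in S,
   and a convex decomposition of x or of g gives one of g (x) x within the ball.
   Conversely, write g (x) x as a convex combination of g_i (x) x_i in S with
   weights t_i. Evaluating on the operators h(.)x, for h a functional, and
   g(.)z, for z in X, gives, with m = g(x),
     x = sum_i t_i m^-1 g_i(x) x_i   and   g = sum_i t_i m^-1 g(x_i) g_i,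
   so by extremality x = m^-1 g_i(x) x_i and g = m^-1 g(x_i) g_i whenever
   t_i > 0, and then g_i (x) x_i = g (x) x. *)
From HB Require Import structures.
Require Import Defs.
From mathcomp Require Import all_boot all_order all_algebra.
From mathcomp Require Import ring lra.
From mathcomp Require Import complex.
From mathcomp Require Import boolp classical_sets functions reals topology.
From mathcomp Require Import normedtype derive.
Import Order.TTheory GRing.Theory Num.Theory.
Import numFieldNormedType.Exports.
Local Open Scope classical_set_scope.
Local Open Scope ring_scope.

Set Implicit Arguments.
Unset Strict Implicit.
Unset Printing Implicit Defensive.

(** * Convex hulls in finite dimension: Caratheodory reduction and separation *)

(** The [#|J| + 2] points [s i], each extended by a coordinate 1, live in dimension [#|J| + 1],
    hence are linearly dependent. Moving the weights along a dependence until one of them reaches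
    zero discards a point. *)
Lemma caratheodory_step (F : realFieldType) (J : finType)
    (t : 'I_#|J|.+2 -> F) (s : 'I_#|J|.+2 -> J -> F) :
  (forall i, 0 <= t i) -> \sum_i t i = 1 ->
  exists (k : 'I_#|J|.+2) (t' : 'I_#|J|.+1 -> F),
    [/\ forall i, 0 <= t' i, \sum_i t' i = 1 &
        forall j, \sum_i t' i * s (lift k i) j = \sum_i t i * s i j].
Proof.
move=> t0 t1.
(* The column [None] of ones forces the coefficients of a dependence to have sum zero, so that the
   total weight is preserved. *)
pose A : 'M[F]_(#|J|.+2, #|{: option J}|) :=
  \matrix_(i, k) (if enum_val k is Some j then s i j else 1).
have [u u0 [us u1]] : exists2 u : 'I_#|J|.+2 -> F, exists i, 0 < u i &
    (forall j, \sum_i u i * s i j = 0) /\ \sum_i u i = 0.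
  have kerA : kermx A != 0.
    rewrite -mxrank_eq0 mxrank_ker subn_eq0 -ltnNge ltnS.
    by apply: (leq_trans (rank_leq_col A)); rewrite card_option.
  have [i [j uij]] : exists i j, kermx A i j != 0.
    apply: contrapT => H; move/eqP: kerA; apply; apply/matrixP => i j.
    by rewrite [RHS]mxE; apply: contrapT => /eqP ?; apply: H; exists i, j.
  have kA k : \sum_j kermx A i j * A j k = 0.
    by have := mulmx_ker A => /matrixP/(_ i k); rewrite !mxE.
  have us (j' : J) : \sum_l kermx A i l * s l j' = 0.
    rewrite -[RHS](kA (enum_rank (Some j'))); apply: eq_bigr => l _.
    by rewrite [A _ _]mxE enum_rankK.
  have u1 : \sum_l kermx A i l = 0.
    rewrite -[RHS](kA (enum_rank None)); apply: eq_bigr => l _.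
    by rewrite [A _ _]mxE enum_rankK mulr1.
  have [l ul] : exists l, 0 < kermx A i l.
    apply: contrapT => H.
    have n0 l : 0 <= - kermx A i l.
      by rewrite oppr_ge0 leNgt; apply/negP => ?; apply: H; exists l.
    have /eqP : \sum_l - kermx A i l = 0 by rewrite sumrN u1 oppr0.
    rewrite psumr_eq0// => /allP/(_ j); rewrite mem_index_enum oppr_eq0.
    by rewrite (negPf uij) => /(_ isT).
  by exists (kermx A i) => //; exists l.
have [i0 ui0] := u0.
(* The minimal ratio makes [t'] vanish at [k] and stay nonnegative where [u i] is positive;
   elsewhere the weights do not decrease. *)
have [k uk kmin] := @arg_minP _ _ _ i0 (fun i => 0 < u i)
  (fun i => t i / u i) ui0.
pose t' i := t i - t k / u k * u i.
have t'k : t' k = 0 by rewrite /t' divfK ?subrr// gt_eqF.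
have t'0 i : 0 <= t' i.
  rewrite /t' subr_ge0; have [ui|ui] := ltP 0 (u i).
    by rewrite -ler_pdivlMr// kmin.
  rewrite (le_trans _ (t0 i))// mulr_ge0_le0// divr_ge0// ltW//.
exists k, (fun i => t' (lift k i)); split=> //.
  have : \sum_i t' i = 1 by rewrite sumrB -mulr_sumr u1 mulr0 subr0.
  by rewrite (bigD1_ord k)//= t'k add0r.
move=> j.
have -> : \sum_i t i * s i j = \sum_i t' i * s i j.
  under [RHS]eq_bigr do rewrite mulrBl -[_ / _ * _ * _]mulrA.
  by rewrite sumrB -mulr_sumr us mulr0 subr0.
by rewrite (bigD1_ord k)//= t'k mul0r add0r.
Qed.

Lemma sum_continuous (K : numFieldType) (T : topologicalType)
    (V : normedModType K) (I : Type) (r : seq I) (f : I -> T -> V) :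
  (forall i, continuous (f i)) -> continuous (fun x => \sum_(i <- r) f i x).
Proof.
move=> cf x; elim: r => [|i r IH].
  by under eq_fun do rewrite big_nil; exact: cst_continuous.
by under eq_fun do rewrite big_cons; apply: continuousD => //; exact: cf.
Qed.

Lemma mx_entry_continuous (T : topologicalType) m n i j :
  continuous (fun M : 'M[T]_(m, n) => M i j).
Proof.
move=> M A /= MA.
exists (fun i' j' => if (i' == i) && (j' == j) then A else setT).
  move=> i' j'; case: ifP => [/andP[/eqP -> /eqP ->]//|_]; exact: filterT.
by move=> B /(_ i j); rewrite !eqxx.
Qed.

(** The last hypothesis says that no linear form strictly separates [p] from the image of [P].
    Combinations of [#|J| + 1] points of that image form a compact set; a nearest one to [p]
    satisfies a first-order condition that contradicts this hypothesis unless it equals [p]. *)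
Lemma convex_hull_separation (R : realType) (T : ptopologicalType) (P : set T)
    (J : finType) (h : J -> T -> R) (p : J -> R) :
  compact P -> (forall j, continuous (h j)) ->
  (forall (c : J -> R) (e : R), 0 < e ->
     exists2 x, P x & \sum_j c j * p j - e <= \sum_j c j * h j x) ->
  exists (t : 'I_#|J|.+1 -> R) (x : 'I_#|J|.+1 -> T),
    [/\ forall i, 0 <= t i, \sum_i t i = 1, forall i, P (x i) &
        forall j, p j = \sum_i t i * h j (x i)].
Proof.
move=> cP ch sep.
set n := #|J|.+1.
pose U : topologicalType := ('rV[R]_n * 'rV[T]_n)%type.
pose wt (v : U) i : R := v.1 ord0 i.
pose pt (v : U) i : T := v.2 ord0 i.
pose Q : set U :=
  ([set t : 'rV[R]_n | forall i, `[(0 : R), 1]%classic (t ord0 i)] `*`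
   [set x : 'rV[T]_n | forall i, P (x ord0 i)]) `&`
  [set v : U | \sum_i wt v i = 1].
have QP v : Q v -> [/\ forall i, 0 <= wt v i, forall i, P (pt v i) &
    \sum_i wt v i = 1].
  move=> [[/= t01 Px] s1]; split => // i.
  by have := t01 i; rewrite in_itv => /andP[].
have cwt i : continuous (wt ^~ i).
  move=> v; apply: (@continuous_comp _ _ _ fst (fun u : 'rV_n => u ord0 i)).
    exact: cvg_fst.
  exact: mx_entry_continuous.
have cpt i : continuous (pt ^~ i).
  move=> v; apply: (@continuous_comp _ _ _ snd (fun u : 'rV_n => u ord0 i)).
    exact: cvg_snd.
  exact: mx_entry_continuous.
have cQ : compact Q.
  apply: compact_closedI.
    apply: compact_setX.
      apply: (@rV_compact R n (fun=> `[0, 1]%classic)) => _.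
      exact: segment_compact.
    exact: (@rV_compact T n (fun=> P)).
  apply: (@preimage_closed _ _ (fun v : U => \sum_i wt v i) [set 1]) => //.
  by move=> v _; apply: sum_continuous.
pose comb v j := \sum_i wt v i * h j (pt v i).
have ccomb j : continuous (comb ^~ j).
  apply: sum_continuous => i v; apply: cvgM; first exact: cwt.
  by apply: continuous_comp; [exact: cpt|exact: ch].
pose g v := \sum_j (comb v j - p j) ^+ 2.
have cg : continuous g.
  apply: sum_continuous => j v; apply: cvgM.
    by apply: cvgB; [exact: ccomb|exact: cvg_cst].
  by apply: cvgB; [exact: ccomb|exact: cvg_cst].
have Q0 : Q !=set0.
  have [x Px _] := sep (fun=> 0) 1 ltr01.
  exists (\row_i (if i == ord0 then 1 else 0), \row__ x); split => [|].
    split => i /=; rewrite mxE// in_itv/=.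
    by case: ifP; rewrite ?lexx ?ler01.
  rewrite /= /wt big_ord_recl mxE/= big1 ?addr0// => i _.
  by rewrite mxE/=.
have [v /set_mem Qv vmin] := compact_EVT_min Q0 cQ (continuous_subspaceT cg).
pose d j := comb v j - p j.
(* Moving from the nearest combination towards the image of [x] adds one point; [caratheodory_step]
   brings the number back to [#|J| + 1], so the new combination still competes in the minimum. *)
have near_s x e : P x -> 0 < e -> e <= 1 ->
    \sum_j d j ^+ 2 <= \sum_j (d j + e * (h j x - comb v j)) ^+ 2.
  move=> Px e0 e1.
  pose t i := if unlift ord0 i is Some k then (1 - e) * wt v k else e.
  pose y i := if unlift ord0 i is Some k then pt v k else x.
  have [] := @caratheodory_step _ J t (fun i j => h j (y i)).
  - move=> i; rewrite /t; case: unliftP => [k _|_]; last exact: ltW.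
    rewrite mulr_ge0 ?subr_ge0//.
    by have [] := QP v Qv.
  - rewrite big_ord_recl /t unlift_none; under eq_bigr do rewrite liftK.
    by rewrite -mulr_sumr; have [_ _ ->] := QP v Qv; rewrite mulr1 addrC subrK.
  move=> k [t' [t'0 t'1 t'E]].
  pose v' : U := (\row_i t' i, \row_i y (lift k i)).
  have Qv' : Q v'.
    split; last by rewrite /= /wt -[RHS]t'1; apply: eq_bigr => i _; rewrite mxE.
    split => i; rewrite /= mxE.
      by rewrite in_itv/= t'0/= -t'1 (bigD1 i)//= lerDl sumr_ge0.
    by rewrite /y; case: unliftP => // l _; have [] := QP v Qv.
  have := vmin v' (mem_set Qv'); rewrite /g => /le_trans; apply.
  apply: ler_sum => j _.
  rewrite le_eqVlt; apply/orP; left; apply/eqP; congr (_ ^+ 2).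
  have -> : comb v' j = \sum_i t i * h j (y i).
    by rewrite -t'E; apply: eq_bigr => i _; rewrite /wt /pt !mxE.
  rewrite big_ord_recl /t /y unlift_none.
  under eq_bigr do rewrite liftK -mulrA.
  rewrite -mulr_sumr -/(comb v j) /d; ring.
(* First-order condition at the minimum, obtained by expanding the squares in [near_s]. *)
have dx x : P x -> 0 <= \sum_j d j * (h j x - comb v j).
  move=> Px; rewrite leNgt; apply/negP => neg.
  set a := \sum_j _ in neg.
  pose b := \sum_j (h j x - comb v j) ^+ 2.
  have b0 : 0 <= b by apply: sumr_ge0 => j _; exact: sqr_ge0.
  have key e : 0 < e -> e <= 1 -> 0 <= 2 * a + e * b.
    move=> e0 e1; have := near_s x e Px e0 e1.
    have -> : \sum_j (d j + e * (h j x - comb v j)) ^+ 2 =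
        \sum_j d j ^+ 2 + e * (2 * a + e * b).
      rewrite mulrDr /a /b !mulr_sumr -!big_split/=.
      by apply: eq_bigr => j _; ring.
    by rewrite lerDl pmulr_rge0.
  have b1 : 0 < b + 1 - a by lra.
  (* The step [q = - a / (b + 1 - a)] lies in (0, 1] since [a < 0 <= b], and [q * b < - a], hence
     [2 * a + q * b < a < 0]. *)
  have e0 : 0 < - a / (b + 1 - a) by rewrite divr_gt0// oppr_gt0.
  have e1 : - a / (b + 1 - a) <= 1 by rewrite ler_pdivrMr//; lra.
  have := key _ e0 e1; set q := - a / _ in e0 *.
  have qE : q * (b + 1 - a) = - a by rewrite divfK// gt_eqF.
  have : 0 < q * (1 - a) by rewrite mulr_gt0//; lra.
  by move: qE; rewrite !mulrDr; lra.
(* Apply [sep] in the direction [- d] with half of the squared distance as margin; since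
   [comb v j = p j + d j], [dx] gives a gap of the whole squared distance. *)
have d0 : \sum_j d j ^+ 2 = 0.
  apply/eqP; rewrite eq_le sumr_ge0 ?andbT => [|j _]; last exact: sqr_ge0.
  rewrite leNgt; apply/negP => dd.
  have e0 : 0 < (\sum_j d j ^+ 2) / 2 by rewrite divr_gt0.
  have [x Px] := sep (fun j => - d j) _ e0.
  have := dx x Px.
  have -> : \sum_j d j * (h j x - comb v j) =
    - \sum_j - d j * h j x - \sum_j d j ^+ 2 + \sum_j - d j * p j.
    rewrite -!sumrN -!big_split/=; apply: eq_bigr => j _; rewrite /d; ring.
  lra.
exists (wt v), (pt v); split.
1-3: by have [] := QP v Qv.
move=> j; apply/esym/eqP; rewrite -subr_eq0 -sqrf_eq0.
move/eqP: d0; rewrite psumr_eq0 => [/allP/(_ j)|k _]; last exact: sqr_ge0.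
by rewrite mem_index_enum => /(_ isT).
Qed.

(** * Real and complex scalars through their real coordinates *)

(* Lets the real and complex cases be treated at once: [re z] and
   [re (im_unit * z)] are the real coordinates of [z]; over the reals
   [im_unit] is 1. *)
Record real_structure (K : numFieldType) := RealStructure {
  reals : realType;
  inj : {rmorphism reals -> K};
  re : K -> reals;
  im_unit : K;
  reD : forall x y, re (x + y) = re x + re y;
  re_injM : forall r z, re (inj r * z) = r * re z;
  inj_re : forall z, 0 <= z -> inj (re z) = z;
  re_ge0 : forall z, 0 <= z -> 0 <= re z;
  inj_ge0 : forall r, 0 <= r -> 0 <= inj r;
  norm_re : forall z, `|re z| <= re `|z|;
  re_im_unit_inj : forall z, re z = 0 -> re (im_unit * z) = 0 -> z = 0;
  ball_compact : forall M : K, compact [set z : K | `|z| <= M]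
}.

Section RealStructureOf.
Variable R : realType.

Lemma real_ball_compact (M : R) : compact [set z : R | `|z| <= M].
Proof.
have -> : [set z : R | `|z| <= M] = `[- M, M]%classic.
  by apply/seteqP; split => z /=; rewrite in_itv/= ler_norml.
exact: segment_compact.
Qed.

Definition real_structure_real : real_structure R.
Proof.
apply: (@RealStructure R R idfun id 1) => //.
exact: real_ball_compact.
Defined.

Let C : numFieldType := R[i].

(** The ball is closed and lies in the image of a compact square under the continuous map that
    assembles a complex number from its two parts. *)
Lemma complex_ball_compact (M : C) : compact [set z : C | `|z| <= M].
Proof.
pose B : set R := [set x | `|x| <= complex.Re M].
pose f (p : R * R) : C := Complex p.1 p.2.
have cf : continuous f.
  move=> p; apply/cvgrPdist_lt => e e0.
  have e0' : 0 < complex.Re e / 2.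
    by move: e0; rewrite ltcE => /andP[_ /= ?]; rewrite divr_gt0.
  have eE : e = ((complex.Re e)%:C)%C.
    by apply/esym/RRe_real; rewrite gtr0_real.
  have n1 : \forall q \near p, `|p.1 - q.1| < complex.Re e / 2.
    by apply: (@cvgr_dist_lt _ _ _ (nbhs p) _ fst p.1) => //; exact: cvg_fst.
  have n2 : \forall q \near p, `|p.2 - q.2| < complex.Re e / 2.
    by apply: (@cvgr_dist_lt _ _ _ (nbhs p) _ snd p.2) => //; exact: cvg_snd.
  near=> q.
  have -> : f p - f q = ((p.1 - q.1)%:C + 'i * (p.2 - q.2)%:C)%C.
    by rewrite /f; simpc.
  rewrite (le_lt_trans (ler_normD _ _))// normrM.
  have nR (x : R) : `|(x%:C)%C| = ((`|x|)%:C)%C :> C.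
    by rewrite normc_def/= expr0n addr0 sqrtr_sqr.
  have -> : `|('i)%C| = 1 :> C.
    by rewrite normc_def/= expr0n expr1n add0r sqrtr1.
  rewrite mul1r !nR -rmorphD/= eE ltcR [ltRHS]splitr ltrD//.
    by near: q.
  by near: q.
have cB : compact (f @` (B `*` B)).
  apply: continuous_compact; first exact: continuous_subspaceT.
  by apply: compact_setX; exact: real_ball_compact.
(* [M] is any element of the field; unless it is real and nonnegative, no norm lies below it and the
   ball is empty. *)
have [M0|M0] := boolP (0 <= M); last first.
  rewrite (_ : mkset _ = set0); first exact: compact0.
  rewrite -subset0 => z /= zM; move/negP: M0; apply; exact: le_trans zM.
apply: subclosed_compact cB _; last first.
  move=> z /= zM; exists (complex.Re z, complex.Im z); last by case: z zM.
  split => /=; rewrite /B/=.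
    rewrite -lecR (le_trans (normc_ge_Re _))// (le_trans zM)//.
    by rewrite RRe_real// ger0_real.
  (* Multiplication by ['i] turns the bound on real parts into one on imaginary parts. *)
  have := normc_ge_Re (z * 'i%C); rewrite ReiNIm normrN normrM.
  have -> : `|('i)%C| = 1 :> C.
    by rewrite normc_def/= expr0n expr1n add0r sqrtr1.
  rewrite mulr1 -lecR => /le_trans; apply; rewrite (le_trans zM)//.
  by rewrite RRe_real// ger0_real.
have -> : [set z : C | `|z| <= M] = ~` [set z | M < `|z|].
  apply/seteqP; split => z /=.
    by move=> zM /(le_lt_trans zM); rewrite ltxx.
  by move/negP; rewrite real_ltNge ?negbK ?ger0_real.
apply: open_closedC; rewrite openE => z /= zM.
apply/nbhs_normP; exists (`|z| - M) => /=; first by rewrite subr_gt0.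
move=> y /=; rewrite ltrBrDr -ltrBrDl => /lt_le_trans; apply.
by rewrite lerBlDr (le_trans _ (ler_normD _ _))// addrC subrK.
Unshelve. all: by end_near. Qed.

Definition real_structure_complex : real_structure R[i].
Proof.
apply: (@RealStructure R[i] R (real_complex R) (@complex.Re R) ('i)%C).
- by move=> [a b] [c d].
- by move=> r [a b] /=; rewrite mul0r subr0.
- by move=> z z0; rewrite /= RRe_real// ger0_real.
- by move=> z; rewrite lecE/= => /andP[].
- by move=> r; rewrite /= ler0c.
- move=> z; rewrite -lecR RRe_real; first exact: normc_ge_Re.
  by rewrite ger0_real.
- move=> [a b] /= ->; rewrite mul0r mul1r sub0r => /eqP; rewrite oppr_eq0.
  by move=> /eqP ->.
- exact: complex_ball_compact.
Defined.

End RealStructureOf.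

Lemma real_or_complex_structure (K : numFieldType) :
  real_or_complex K -> inhabited (real_structure K).
Proof.
case=> R; constructor; first exact: real_structure_real.
exact: real_structure_complex.
Qed.

Arguments reD {K} r0 x y.
Arguments re_injM {K} r0 r z.
Arguments inj_re {K} r0 [z].
Arguments re_ge0 {K} r0 [z].
Arguments inj_ge0 {K} r0 [r].
Arguments norm_re {K} r0 z.
Arguments ball_compact {K} r0 M.

(** * Linear maps, suprema and the dual norm *)

Lemma linear_zero (K : numFieldType) (U V : lmodType K) (f : U -> V) :
  linear f -> f 0 = 0.
Proof.
by move=> lf; have := lf (-1) 0 0; rewrite scaler0 addr0 scaleN1r addNr. Qed.

Lemma linear_comb (K : numFieldType) (U V : lmodType K) (f : U -> V)
    (I : Type) (s : seq I) (c : I -> K) (u : I -> U) :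
  linear f -> f (\sum_(i <- s) c i *: u i) = \sum_(i <- s) c i *: f (u i).
Proof.
move=> lf; elim: s => [|i s IH]; first by rewrite !big_nil linear_zero.
by rewrite !big_cons lf IH.
Qed.

Lemma linear_functionalZ (K : numFieldType) (X : lmodType K) (f : X -> K^o)
    (a : K) (x : X) :
  linear f -> f (a *: x) = a * f x.
Proof. by move=> lf; rewrite -[a *: x]addr0 lf (linear_zero lf) addr0. Qed.

Section RealStructureTheory.
Variables (K : numFieldType) (rs : real_structure K).
Local Notation R := (reals rs).
Local Notation inj := (inj rs).
Local Notation re := (re rs).

Lemma re0 : re 0 = 0.
Proof. by apply: (addrI (re 0)); rewrite -reD !addr0. Qed.

Lemma reN x : re (- x) = - re x.
Proof. by apply: (addrI (re x)); rewrite -reD !subrr re0. Qed.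

Lemma reB x y : re (x - y) = re x - re y.
Proof. by rewrite reD reN. Qed.

Lemma re_sum (I : Type) (s : seq I) (P : pred I) (F : I -> K) :
  re (\sum_(i <- s | P i) F i) = \sum_(i <- s | P i) re (F i).
Proof. exact: (big_morph re (reD rs) re0). Qed.

Lemma re_le x y : x <= y -> re x <= re y.
Proof. by rewrite -subr_ge0 => /(re_ge0 rs); rewrite reB subr_ge0. Qed.

Lemma inj_le x y : x <= y -> inj x <= inj y.
Proof. by rewrite -subr_ge0 => /(inj_ge0 rs); rewrite rmorphB subr_ge0. Qed.

Lemma reK r : re (inj r) = r.
Proof.
have re1 : re 1 = 1.
  by apply: (fmorph_inj inj); rewrite (inj_re rs)// rmorph1.
by rewrite -[inj r]mulr1 re_injM re1 mulr1.
Qed.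

Lemma re_norm_gt0 (V : normedModType K) (v : V) : v != 0 -> 0 < re `|v|.
Proof.
move=> v0; rewrite lt_neqAle re_ge0// andbT eq_sym; apply: contra_neq v0.
by move=> /(congr1 inj); rewrite inj_re// rmorph0 => /normr0_eq0.
Qed.

Lemma re_continuous : continuous (re : K -> R).
Proof.
move=> x; apply/(@cvgrPdist_lt _ _ _ (nbhs x)) => e e0.
apply/nbhs_normP; exists (inj e) => /=.
  by rewrite lt_neqAle eq_sym fmorph_eq0 (gt_eqF e0)/= inj_ge0// ltW.
move=> y /= xy; rewrite -reB (le_lt_trans (norm_re _ _))//.
rewrite -[e]reK -subr_gt0 -reB.
have d0 : 0 < inj e - `|x - y| by rewrite subr_gt0.
rewrite lt_neqAle re_ge0 ?(ltW d0)// andbT eq_sym; apply/negP => /eqP.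
move=> /(congr1 inj); rewrite inj_re ?(ltW d0)// rmorph0 => d.
by rewrite d ltxx in d0.
Qed.

(** The order of [K] may be partial, so the supremum is taken in the reals: its image under [inj] is
    a least upper bound in [K], and [supremum] then returns a least upper bound and not its default
    value. *)
Lemma supremum_nonneg (A : set K) (M : K) : A !=set0 ->
  (forall a, A a -> 0 <= a <= M) ->
  (forall a, A a -> a <= supremum 0 A) /\
  (forall c, (forall a, A a -> a <= c) -> supremum 0 A <= c).
Proof.
move=> [a0 Aa0] AM.
have A0 : A != set0 by apply/set0P; exists a0.
have A_ge0 a : A a -> 0 <= a by move=> /AM/andP[].
have hs : has_sup (re @` A).
  split; first by exists (re a0), a0.
  by exists (re M) => _ [a /AM/andP[_ aM] <-]; exact: re_le.
have sA : supremums A (inj (sup (re @` A))).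
  split=> [a Aa|u uA].
    rewrite -(inj_re rs (A_ge0 _ Aa)); apply: inj_le.
    by apply: sup_upper_bound => //; exists a.
  (* An upper bound in [K] dominates a nonnegative element, so it is nonnegative and [inj] recovers
     it from its real part. *)
  have u0 : 0 <= u by apply: le_trans (uA _ Aa0); exact: A_ge0.
  rewrite -(inj_re rs u0); apply: inj_le; apply: ge_sup; first by case: hs.
  by move=> _ [a Aa <-]; apply: re_le; exact: uA.
rewrite /supremum (negPf A0); case: xgetP => [s _ [us ls]|/(_ _ sA)//].
by split => // c cA; apply: ls => a; exact: cA.
Qed.

Lemma dual_linear (Z : normedModType K) (f : Z -> K^o) :
  dual Z f -> exists2 M, 0 <= M & forall z, `|f z| <= M * `|z|.
Proof.
move=> [lf cf].
pose g : {linear Z -> K^o} := HB.pack f (GRing.isLinear.Build _ _ _ _ f lf).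
have /linear_bounded_continuous/linear_boundedP : continuous g by exact: cf.
(* The estimate holds for constants strictly above a real [M] of unknown sign, whence the absolute
   value and the 1. *)
move=> [M [Mr HM]]; exists (`|M| + 1); first by rewrite addr_ge0.
by apply: HM; rewrite (le_lt_trans (real_ler_norm _))// ltrDl.
Qed.

Lemma dual_normP (Z : normedModType K) (f : Z -> K^o) : dual Z f ->
  (forall z, `|z| <= 1 -> `|f z| <= dual_norm f) /\
  (forall c, (forall z, `|z| <= 1 -> `|f z| <= c) -> dual_norm f <= c).
Proof.
move=> /[dup] df /dual_linear[M M0 HM].
have [|a Aa|H1 H2] := @supremum_nonneg [set `|f z| | z in unit_ball Z] M.
- by exists `|f 0|, 0 => //=; rewrite /unit_ball/= normr0.
- move: Aa => [z /= z1 <-]; rewrite normr_ge0/= (le_trans (HM z))//.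
  by rewrite ler_piMr.
split; first by move=> z z1; apply: H1; exists z.
by move=> c Hc; apply: H2 => _ [z z1 <-]; exact: Hc.
Qed.

Lemma contractive_dual (Z : normedModType K) (f : Z -> K^o) :
  linear f -> (forall z, `|f z| <= `|z|) -> dual Z f.
Proof.
move=> lf f1; split=> //.
pose g : {linear Z -> K^o} := HB.pack f (GRing.isLinear.Build _ _ _ _ f lf).
have : continuous g; last by [].
apply/linear_bounded_continuous/bounded_funP => r; exists r => x xr.
exact: le_trans (f1 x) xr.
Qed.

(** Homogeneity extends the bound from the unit ball to all vectors, and a contractive linear
    functional is continuous. This description avoids both suprema and topology. *)
Lemma dual_ballE (Z : normedModType K) (f : Z -> K^o) :
  dual_ball Z f <-> linear f /\ forall z, `|f z| <= `|z|.
Proof.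
split=> [[df f1]|[lf f1]].
  have lf : linear f by case: df.
  pose g : {linear Z -> K^o} := HB.pack f (GRing.isLinear.Build _ _ _ _ f lf).
  split=> // z; have [->|z0] := eqVneq z 0.
    by rewrite -[f]/(g : Z -> _) linear0 !normr0.
  have nz : 0 < `|z| by rewrite normr_gt0.
  have [H _] := dual_normP df.
  have := H (`|z|^-1 *: z); rewrite normrZ normfV normr_id mulVf ?gt_eqF//.
  move=> /(_ (lexx _)) /le_trans /(_ f1).
  rewrite -[f]/(g : Z -> _) linearZ/= normrM normfV normr_id.
  by rewrite ler_pdivrMl// mulr1.
have df := contractive_dual lf f1; split=> //.
have [_ H] := dual_normP df; apply: H => z z1; exact: le_trans (f1 z) z1.
Qed.

Lemma dual_sphereP (Z : normedModType K) (f : Z -> K^o) z :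
  dual_ball Z f -> `|z| <= 1 -> `|f z| = 1 -> dual_sphere f.
Proof.
move=> [df f1] z1 fz; split=> //; apply/eqP; rewrite eq_le f1/= -fz.
by have [H _] := dual_normP df; exact: H.
Qed.

End RealStructureTheory.

(** * Coordinates in a finite-dimensional space *)

(** A spanning family of least size is free, so the coordinates chosen for each vector are unique,
    and uniqueness makes them linear. *)
Lemma finite_dimensional_basis (K : numFieldType) (V : lmodType K) :
  finite_dimensional V ->
  exists n (e : 'I_n -> V) (xi : 'I_n -> V -> K^o),
    [/\ forall x, x = \sum_i xi i x *: e i,
        forall i, linear (xi i) &
        forall (c : 'I_n -> K) i, xi i (\sum_j c j *: e j) = c i].
Proof.
move=> fd.
pose spans n := exists e : 'I_n -> V, forall x, exists c : 'I_n -> K,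
  x = \sum_(i < n) c i *: e i.
have exn : exists n, `[< spans n >].
  by case: fd => n He; exists n; apply/asboolP.
case: (ex_minnP exn) => n /asboolP[e espan] nmin.
have free (c : 'I_n -> K) : \sum_i c i *: e i = 0 -> forall i, c i = 0.
  move=> c0 k; apply: contrapT => /eqP ck.
  case: n => [|n] in e c espan nmin c0 k ck *.
    by case: k {ck}.
  (* A nonzero [c k] expresses [e k] through the other vectors, which then span, against
     minimality. *)
  suff /asboolP/nmin : spans n by rewrite ltnn.
  exists (e \o lift k) => x; have [d ->] := espan x.
  exists (fun j => d (lift k j) - d k / c k * c (lift k j)).
  have ek : e k = - \sum_j (c (lift k j) / c k) *: e (lift k j).
    apply: (scalerI ck); rewrite scalerN scaler_sumr.
    move: c0; rewrite (bigD1_ord k)//= => /eqP; rewrite addr_eq0 => /eqP ->.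
    by congr (- _); apply: eq_bigr => j _; rewrite scalerA mulrCA mulfV// mulr1.
  rewrite (bigD1_ord k)//= [in LHS]ek scalerN scaler_sumr -sumrN -big_split/=.
  apply: eq_bigr => j _; rewrite scalerBl addrC scalerA; congr (_ - _ *: _).
  by rewrite mulrA mulrAC.
have [xi xiE] := choice espan.
have uniq_coord (c d : 'I_n -> K) :
    \sum_i c i *: e i = \sum_i d i *: e i -> forall i, c i = d i.
  move=> cd i; apply/eqP; rewrite -subr_eq0; apply/eqP.
  apply: (free (fun i => c i - d i)).
  by under eq_bigr do rewrite scalerBl; rewrite sumrB cd subrr.
exists n, e, (fun i x => xi x i); split => //.
- move=> i a x y; apply: (uniq_coord (xi (a *: x + y))
    (fun i => a * xi x i + xi y i)) i.
  rewrite -xiE [in LHS](xiE x) [in LHS](xiE y) scaler_sumr -big_split/=.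
  by apply: eq_bigr => i _; rewrite scalerDl scalerA.
- by move=> c i; apply: (uniq_coord (xi _) c) i; rewrite -xiE.
Qed.

Lemma row_sum_continuous (K : numFieldType) (V : normedModType K) n
    (e : 'I_n -> V) :
  continuous (fun v : 'rV[K]_n => \sum_i v ord0 i *: e i).
Proof.
apply: sum_continuous => i v; apply: (@cvgZr_tmp _ _ _ (nbhs v)).
exact: coord_continuous.
Qed.

Lemma re_norm_continuous (K : numFieldType) (rs : real_structure K)
    (T : topologicalType) (V : normedModType K) (f : T -> V) :
  continuous f -> continuous (fun x => re rs `|f x|).
Proof.
move=> cf x; apply: (@continuous_comp _ _ _ (fun x => `|f x|) (re rs)).
  by apply: (@cvg_norm _ _ _ (nbhs x)); exact: cf.
exact: re_continuous.
Qed.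

(** Equivalence of norms by compactness: over the coefficient vectors whose moduli have sum 1, the
    norm of the combination of the [e i] attains a positive minimum [m], and rescaling gives the
    constant [m^-1]. *)
Lemma coordinate_bound (K : numFieldType) (rs : real_structure K)
    (V : normedModType K) n (e : 'I_n -> V) (xi : 'I_n -> V -> K^o) :
  (forall x, x = \sum_i xi i x *: e i) ->
  (forall (c : 'I_n -> K) i, xi i (\sum_j c j *: e j) = c i) ->
  exists2 C : K, 0 <= C & forall i x, `|xi i x| <= C * `|x|.
Proof.
move=> xiE xi_sum.
pose s (v : 'rV[K]_n) := \sum_i re rs `|v ord0 i|.
pose A := [set v : 'rV[K]_n | forall i, [set z : K | `|z| <= 1] (v ord0 i)]
  `&` [set v | s v = 1].
have cs : continuous s.
  apply: sum_continuous => i.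
  by apply: (@re_norm_continuous K rs _ K^o); exact: coord_continuous.
have cA : compact A.
  apply: compact_closedI.
    apply: (@rV_compact K n (fun=> [set z : K | `|z| <= 1])) => _.
    exact: (ball_compact rs).
  by apply: (@preimage_closed _ _ s [set 1]) => // v _; exact: cs.
have [m m0 mA] : exists2 m : reals rs, 0 < m &
    forall v, A v -> m <= re rs `|\sum_i v ord0 i *: e i|.
  (* For [n = 0] there is no such coefficient vector, and any positive [m] will do. *)
  have [A0|/nonemptyPn A0] := pselect (A !=set0); last first.
    by exists 1 => // v; rewrite A0.
  have cN : continuous (fun v : 'rV[K]_n => re rs `|\sum_i v ord0 i *: e i|).
    by apply: re_norm_continuous; exact: row_sum_continuous.
  have [v /set_mem[v1 sv] vmin] :=
    compact_EVT_min A0 cA (continuous_subspaceT cN).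
  exists (re rs `|\sum_i v ord0 i *: e i|); last first.
    by move=> u Au; apply: vmin; exact: mem_set.
  apply: re_norm_gt0; apply/eqP => ve0.
  have := oner_neq0 (reals rs); rewrite -sv => /eqP; apply.
  rewrite /s big1// => i _; rewrite -(xi_sum (v ord0) i) ve0.
  have -> : 0 = \sum_j 0 *: e j by rewrite big1// => j _; rewrite scale0r.
  by rewrite (xi_sum (fun=> 0)) normr0 re0.
exists (inj rs m^-1); first by rewrite inj_ge0// invr_ge0 ltW.
move=> i x.
pose c : 'rV[K]_n := \row_j xi j x.
have le_s j : re rs `|xi j x| <= s c.
  rewrite /s (bigD1 j)//= mxE lerDl sumr_ge0// => k _; exact: re_ge0.
rewrite -(inj_re rs (normr_ge0 (xi i x))) -(inj_re rs (normr_ge0 x)) -rmorphM.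
apply: inj_le; rewrite (le_trans (le_s i))//.
have [s0|s0] := leP (s c) 0.
  by rewrite (le_trans s0)// mulr_ge0 ?invr_ge0 ?(ltW m0)// re_ge0.
pose v := inj rs (s c)^-1 *: c.
have nv k : re rs `|v ord0 k| = (s c)^-1 * re rs `|xi k x|.
  by rewrite !mxE normrM ger0_norm ?inj_ge0 ?invr_ge0 ?(ltW s0)// re_injM.
have : A v.
  split => [k|] /=.
    rewrite -(inj_re rs (normr_ge0 _)) -(rmorph1 (inj rs)); apply: inj_le.
    by rewrite nv ler_pdivrMl// mulr1.
  rewrite /s; under eq_bigr do rewrite nv.
  rewrite -mulr_sumr -[X in _ * X](_ : s c = _) ?mulVf ?gt_eqF//.
  by apply: eq_bigr => k _; rewrite mxE.
move=> /mA; have -> : \sum_k v ord0 k *: e k = inj rs (s c)^-1 *: x.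
  rewrite [in RHS](xiE x) scaler_sumr; apply: eq_bigr => k _.
  by rewrite !mxE scalerA.
rewrite normrZ ger0_norm ?inj_ge0 ?invr_ge0 ?(ltW s0)// re_injM.
by rewrite ler_pdivlMl// mulrC -ler_pdivlMl.
Qed.

(** * The numerical radius as a supremum over norming pairs *)

Section NumericalRadius.
Variables (K : numFieldType) (rs : real_structure K) (X : normedModType K).
Implicit Type T : bounded_operator X.

(** Pairs representing the functionals whose hull is the dual ball. Modulus 1, rather than value 1,
    keeps the set stable under unimodular scalars. *)
Definition norming_pairs : set ((X -> K^o) * X) :=
  [set p | [/\ dual_ball X p.1, unit_ball X p.2 & `|p.1 p.2| = 1]].

Lemma bounded_operatorP T :
  linear T /\ exists2 M : K, 0 <= M & forall x, `|T x| <= M * `|x|.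
Proof.
have : operator_fun T \in @bounded_linear K X by case: T.
move=> /asboolP[lT [M MT]]; split=> //.
have [x0|] := pselect (exists x : X, x != 0).
  have [x nx] := x0; exists M => //.
  have := le_trans (normr_ge0 _) (MT x).
  by rewrite pmulr_lge0// normr_gt0.
move=> X0; exists 0 => // x; have -> : x = 0.
  by apply: contrapT => /eqP ?; apply: X0; exists x.
by rewrite (linear_zero lT) normr0 mul0r.
Qed.

(** Dividing the functional of a norming pair by its unimodular value at the vector gives a pair of
    the kind that defines the numerical radius, and leaves the modulus of its value at [T p.2]
    unchanged. *)
Lemma numerical_radiusP T :
  (forall p, norming_pairs p -> `|p.1 (T p.2)| <= numerical_radius T) /\
  (forall c, 0 <= c -> (forall p, norming_pairs p -> `|p.1 (T p.2)| <= c) ->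
    numerical_radius T <= c).
Proof.
have [lT [M M0 TM]] := bounded_operatorP T.
rewrite /numerical_radius; set A := mkset _.
have A_M a : A a -> 0 <= a <= M.
  move=> [f [x [[df f1] x1 fx ->]]]; rewrite normr_ge0/=.
  have [_ fc] : linear f /\ forall z, `|f z| <= `|z|.
    by apply/(dual_ballE rs); split=> //; rewrite f1.
  by rewrite (le_trans (fc _))// (le_trans (TM _))// x1 mulr1.
have A_in p : norming_pairs p -> A `|p.1 (T p.2)|.
  case: p => f x [/= /(dual_ballE rs)[lf fc] x1 fx].
  have xE : `|x| = 1 by apply/eqP; rewrite eq_le x1 -fx fc.
  pose g : X -> K^o := (f x)^-1 *: f.
  have gz z : g z = (f x)^-1 * f z by [].
  have ng z : `|g z| = `|f z| by rewrite gz normrM normfV fx invr1 mul1r.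
  have fx0 : f x != 0 by rewrite -normr_eq0 fx oner_eq0.
  have dg : dual_ball X g.
    apply/(dual_ballE rs); split=> [a u v|z]; last by rewrite ng.
    by rewrite !gz lf mulrDr mulrCA.
  exists g, x; split.
  - by apply: (dual_sphereP rs dg x1); rewrite ng.
  - exact: xE.
  - by rewrite gz mulVf.
  - by rewrite ng.
have out p : (exists f x, [/\ dual_sphere f, unit_sphere x, f x = 1 &
    p = (f, x)]) -> norming_pairs p.
  move=> [f [x [[df f1] x1 fx ->]]]; split => /=.
  - by split => //; rewrite f1.
  - by rewrite /unit_ball/= x1.
  - by rewrite fx normr1.
split=> [p /A_in Ap|c c0 Hc].
  have [|H _] := @supremum_nonneg _ rs A M _ A_M; last exact: H.
  exact: (ex_intro _ _ Ap).
(* The supremum of the empty set is 0 by default, which the condition [0 <= c] covers. *)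
have [A0|/nonemptyPn ->] := pselect (A !=set0); last by rewrite supremum0.
have [_ H] := @supremum_nonneg _ rs A M A0 A_M; apply: H.
move=> _ [f [x [df x1 fx ->]]]; apply: (Hc (f, x)).
by apply: out; exists f, x.
Qed.

End NumericalRadius.

(** * The unit ball of the dual of the operator space as a convex hull *)

Section DualBallHull.
Variables (K : numFieldType) (rs : real_structure K) (X : normedModType K).
Variable w_norm : is_norm (@numerical_radius K X).
Hypothesis X_neq0 : exists x : X, x != 0.

(** Without any such pair the identity would have numerical radius 0, so it would vanish, although
    [X] has a nonzero vector. *)
Lemma norming_pairs_neq0 : @norming_pairs K X !=set0.
Proof.
apply/set0P/negP => /eqP S0.
have idb : (id : X -> X) \in @bounded_linear K X.
  by apply/asboolP; split=> //; exists 1 => x; rewrite mul1r.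
pose I := BoundedOperator idb.
have [w0 w_eq0 _ _] := w_norm.
have [_ H] := numerical_radiusP rs I.
have I0 : I = 0.
  apply: w_eq0; apply/eqP; rewrite eq_le w0 andbT; apply: H => // p.
  by rewrite S0.
have [x] := X_neq0; have -> : x = I x by [].
by rewrite I0 eqxx.
Qed.

Lemma norming_pairs_scale (l : K) (f : X -> K^o) x : `|l| = 1 ->
  norming_pairs (f, x) -> norming_pairs (l *: f : X -> K^o, x).
Proof.
move=> l1 [/= /(dual_ballE rs)[lf fc] x1 fx]; split => //=; last first.
  by rewrite -[(l *: f) x]/(l * f x) normrM l1 mul1r.
apply/(dual_ballE rs); split => [a u v|z].
  by rewrite -![(l *: f) _]/(l * f _) lf mulrDr mulrCA.
by rewrite -[(l *: f) z]/(l * f z) normrM l1 mul1r.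
Qed.

(** This supplies the hypothesis of [convex_hull_separation]. If every pair failed, rotation by
    unimodular scalars would bound w(T) by [re rs (f T) - e], whereas the real part of [f T] is at
    most w(T). *)
Lemma norming_pairs_separation f (T : bounded_operator X) (e : reals rs) :
  dual_ball (operator_w w_norm) f -> 0 < e ->
  exists2 p, norming_pairs p & re rs (f T) - e <= re rs (p.1 (T p.2)).
Proof.
move=> /(dual_ballE rs)[lf fc] e0; apply: contrapT => H.
have lt p : norming_pairs p -> re rs (p.1 (T p.2)) < re rs (f T) - e.
  by move=> Sp; rewrite ltNge; apply/negP => le; apply: H; exists p.
have norm_lt p : norming_pairs p -> re rs `|p.1 (T p.2)| < re rs (f T) - e.
  case: p => g x Sp /=; have [g0|g0] := eqVneq (g (T x)) 0.
    by have := lt _ Sp; rewrite /= g0 normr0.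
  (* This scalar rotates [g (T x)] onto its modulus. *)
  pose l := `|g (T x)| / g (T x).
  have l1 : `|l| = 1 by rewrite normrM normr_id normfV mulfV// normr_eq0.
  have := lt _ (norming_pairs_scale l1 Sp); rewrite /=.
  by rewrite -[(l *: g) _]/(l * g _) divfK.
(* One pair suffices to see that the bound is nonnegative, as [numerical_radiusP] requires. *)
have [p0 Sp0] := norming_pairs_neq0.
have r0 : 0 <= re rs (f T) - e.
  by apply: ltW; apply: le_lt_trans (norm_lt _ Sp0); exact: re_ge0.
have [_ /(_ (inj rs (re rs (f T) - e)))] := numerical_radiusP rs T.
move=> /(_ (inj_ge0 rs r0)).
have Hw : forall p : (X -> K^o) * X, norming_pairs p ->
    `|p.1 (T p.2)| <= inj rs (re rs (f T) - e).
  move=> p /norm_lt /ltW /inj_le.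
  by rewrite inj_re.
move=> /(_ Hw) /(re_le rs); rewrite reK.
have := re_le rs (fc T : `|f T| <= numerical_radius T).
have := norm_re rs (f T).
by have := ler_norm (re rs (f T)); lra.
Qed.

Variables (n : nat) (e : 'I_n -> X) (xi : 'I_n -> X -> K^o).
Hypothesis xiE : forall x, x = \sum_i xi i x *: e i.
Hypothesis xi_linear : forall i, linear (xi i).
Hypothesis xi_sum : forall (c : 'I_n -> K) i, xi i (\sum_j c j *: e j) = c i.

Lemma coordinateZ i j a : xi i (a *: e j) = a * (i == j)%:R.
Proof.
have -> : a *: e j = \sum_k (a * (k == j)%:R) *: e k.
  rewrite (bigD1 j)//= eqxx mulr1 big1 ?addr0// => k /negPf ->.
  by rewrite mulr0 scale0r.
by rewrite (xi_sum (fun k => a * (k == j)%:R)).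
Qed.

Lemma rank_one_operator (f : X -> K^o) (y : X) :
  linear f -> (exists C, forall x, `|f x| <= C * `|x|) ->
  exists T : bounded_operator X, forall x, T x = f x *: y.
Proof.
move=> lf [C fC].
have Tb : (fun x => f x *: y) \in @bounded_linear K X.
  apply/asboolP; split=> [a u v|].
    by rewrite lf scalerDl scalerA.
  exists (C * `|y|) => x; rewrite normrZ mulrAC ler_wpM2r//.
by exists (BoundedOperator Tb).
Qed.

Lemma coordinate_operator i y :
  exists T : bounded_operator X, forall x, T x = xi i x *: y.
Proof.
apply: rank_one_operator => //.
have [C _ HC] := coordinate_bound rs xiE xi_sum.
by exists C => x; exact: HC.
Qed.

Lemma operator_ext (S T : bounded_operator X) : (forall x, S x = T x) -> S = T.
Proof. by move=> ST; apply: val_inj; apply: funext. Qed.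

Lemma operator_sumE (I : Type) (s : seq I) (F : I -> bounded_operator X) x :
  (\sum_(i <- s) F i) x = \sum_(i <- s) F i x.
Proof.
elim: s => [|i s IH]; first by rewrite !big_nil.
by rewrite !big_cons -IH.
Qed.

(** A functional on operators is determined by its values at the matrix units [E ij], that is, by
    finitely many real coordinates. Norming pairs are encoded by a compact set [P] on which these
    coordinates are continuous, and [convex_hull_separation] applies. *)
Lemma dual_ball_hull f : dual_ball (operator_w w_norm) f ->
  exists (m : nat) (t : 'I_m -> K) (p : 'I_m -> (X -> K^o) * X),
    [/\ forall i, 0 <= t i, \sum_i t i = 1, forall i, norming_pairs (p i) &
        forall T : bounded_operator X, f T = \sum_i t i * (p i).1 (T (p i).2)].
Proof.
move=> df.
have lf : linear f by have [] := (dual_ballE rs f).1 df.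
have [C C0 HC] := coordinate_bound rs xiE xi_sum.
have [E EE] := choice (fun ij : 'I_n * 'I_n =>
  coordinate_operator ij.1 (e ij.2)).
(* The boolean selects which real coordinate of a scalar [re] reads after multiplication. *)
pose un (b : bool) : K := if b then im_unit rs else 1.
pose J := ('I_n * 'I_n * bool)%type.
pose F (j : J) : bounded_operator X := un j.2 *: E j.1.
(* A row stores a pair: first the values of the functional at the basis, then the coordinates of the
   vector. *)
pose Rn := 'rV[K]_(n + n).
pose fa (v : Rn) j : K := v ord0 (lshift n j).
pose fb (v : Rn) i : K := v ord0 (rshift n i).
pose gf (v : Rn) : X -> K^o := fun x => \sum_j xi j x * fa v j.
pose gx (v : Rn) : X := \sum_i fb v i *: e i.
pose h (j : J) (v : Rn) : reals rs :=
  re rs (un j.2 * (fb v j.1.1 * fa v j.1.2)).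
(* Norming pairs satisfy these bounds, by contractivity of the functional and by [coordinate_bound];
   they confine [P] to a compact product. *)
pose box (k : 'I_(n + n)) : set K :=
  [set z | `|z| <= match fintype.split k with inl j => `|e j| | inr i => C end].
pose P : set Rn := [set v : Rn | forall k, box k (v ord0 k)] `&`
  ((\bigcap_(x in [set: X]) [set v : Rn | re rs `|gf v x| <= re rs `|x|]) `&`
  ([set v : Rn | re rs `|gx v| <= 1] `&`
   [set v : Rn | re rs `|gf v (gx v)| = 1])).
have ca j : continuous (fa ^~ j) by exact: coord_continuous.
have cb i : continuous (fb ^~ i) by exact: coord_continuous.
have cgf x : continuous (gf ^~ x).
  apply: (@sum_continuous K Rn K^o) => j v.
  by apply: (@cvgM _ _ (nbhs v)); [exact: cvg_cst|exact: ca].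
have cgx : continuous gx.
  apply: sum_continuous => i v.
  apply: (@cvgZr_tmp _ _ _ (nbhs v)); exact: cb.
have gfE v : gf v (gx v) = \sum_j fb v j * fa v j.
  by apply: eq_bigr => j _; rewrite xi_sum.
have cgfx : continuous (fun v => gf v (gx v)).
  rewrite (_ : (fun v => gf v (gx v)) = fun v => \sum_j fb v j * fa v j).
    apply: (@sum_continuous K Rn K^o) => j v.
    by apply: (@cvgM _ _ (nbhs v)); [exact: cb|exact: ca].
  by apply: funext => v; exact: gfE.
have ch j : continuous (h j).
  move=> v; apply: (@continuous_comp _ _ _
    (fun v => un j.2 * (fb v j.1.1 * fa v j.1.2)) (re rs));
    last exact: re_continuous.
  apply: (@cvgM _ _ (nbhs v)); first exact: cvg_cst.
  by apply: (@cvgM _ _ (nbhs v)); [exact: cb|exact: ca].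
have cP : compact P.
  apply: compact_closedI.
    by apply: (@rV_compact K (n + n) box) => k; exact: (ball_compact rs).
  apply: closedI; last apply: closedI.
  - apply: closed_bigI => x _.
    apply: (@preimage_closed _ _ (fun v => re rs `|gf v x|)
      [set r | r <= re rs `|x|]) => //.
    by move=> v _; apply: (@re_norm_continuous K rs Rn K^o).
  - apply: (@preimage_closed _ _ (fun v => re rs `|gx v|)
      [set r | r <= 1]) => //.
    by move=> v _; apply: re_norm_continuous.
  - apply: (@preimage_closed _ _ (fun v => re rs `|gf v (gx v)|) [set 1]) => //.
    by move=> v _; apply: (@re_norm_continuous K rs Rn K^o).
have le_re (x y : K) : 0 <= x -> 0 <= y -> re rs x <= re rs y -> x <= y.
  by move=> x0 y0 xy; rewrite -(inj_re rs x0) -(inj_re rs y0); exact: inj_le.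
have PS v : P v -> norming_pairs (gf v, gx v).
  move=> [_ [Pf [Px Pfx]]]; split => /=.
  - apply/(dual_ballE rs); split=> [a x y|x].
      rewrite /gf scaler_sumr -big_split/=; apply: eq_bigr => j _.
      by rewrite xi_linear mulrDl -mulrA.
    by apply: le_re => //; exact: Pf.
  - by apply: le_re => //; rewrite -(rmorph1 (inj rs)) reK.
  - by rewrite -(inj_re rs (normr_ge0 _)) Pfx rmorph1.
have tensorF v j : re rs (gf v (F j (gx v))) = h j v.
  rewrite /h; congr (re rs _).
  have -> : F j (gx v) = un j.2 *: (fb v j.1.1 *: e j.1.2).
    by rewrite -[F j _]/(un j.2 *: E j.1 _) EE /gx xi_sum.
  rewrite scalerA /gf (bigD1 j.1.2)//= big1 => [|k kj].
    by rewrite addr0 coordinateZ eqxx mulr1 mulrA.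
  by rewrite coordinateZ (negPf kj) mulr0 mul0r.
have [|t [v [t0 t1 Pv vE]]] := @convex_hull_separation (reals rs) Rn P J h
    (fun j => re rs (f (F j))) cP ch.
  (* A linear form with real coefficients [c] amounts to evaluation at this operator followed by the
     real part. *)
  move=> c eps eps0; pose T := \sum_j inj rs (c j) *: F j.
  have fT (g : bounded_operator X -> K) :
      linear (g : _ -> K^o) -> re rs (g T) = \sum_j c j * re rs (g (F j)).
    move=> lg; rewrite /T (linear_comb _ _ _ lg) re_sum.
    by apply: eq_bigr => j _; exact: re_injM.
  have [[g x] Sp] := norming_pairs_separation T df eps0.
  have [/= /(dual_ballE rs)[lg gc] x1 gx1] := Sp.
  pose v : Rn := \row_k
    match fintype.split k with inl j => g (e j) | inr i => xi i x end.
  have fav j : fa v j = g (e j).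
    by rewrite /fa mxE (unsplitK (inl j)).
  have fbv i : fb v i = xi i x.
    by rewrite /fb mxE (unsplitK (inr i)).
  have gxv : gx v = x by rewrite [RHS]xiE; apply: eq_bigr => i _; rewrite fbv.
  have gfv : gf v = g.
    apply: funext => z; rewrite [in RHS](xiE z) (linear_comb _ _ _ lg).
    by apply: eq_bigr => i _; rewrite fav.
  have Pv : P v.
    split => [k|].
      rewrite mxE /box/=; case: (fintype.split k) => [j|i]; first exact: gc.
      by rewrite (le_trans (HC i x))// ler_piMr.
    split; last split => /=.
    - by move=> z _ /=; rewrite gfv; exact: re_le.
    - by rewrite gxv -(reK (1 : reals rs)) rmorph1; exact: re_le.
    - by rewrite gfv gxv gx1 -(rmorph1 (inj rs)) reK.
  have lin_gx : linear ((fun S : bounded_operator X => g (S x)) : _ -> K^o).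
    by move=> a S1 S2; rewrite -lg.
  rewrite (fT f lf) (fT (fun S => g (S x)) lin_gx) => le_sep.
  exists v => //; apply: le_trans le_sep _; apply: ler_sum => j _.
  by rewrite -tensorF gfv gxv.
exists #|{: J}|.+1, (fun i => inj rs (t i)), (fun i => (gf (v i), gx (v i))).
split.
- by move=> i; exact: inj_ge0.
- by rewrite -rmorph_sum t1 rmorph1.
- by move=> i; exact: PS.
move=> T.
(* The error of the representation is linear; it vanishes at each [E ij], since both its real
   coordinates do, and the [E ij] span all operators. *)
pose d (S : bounded_operator X) : K^o :=
  f S - \sum_i inj rs (t i) * gf (v i) (S (gx (v i))).
have ld : linear d.
  move=> a S1 S2; rewrite /d lf scalerBr addrACA -opprD; congr (_ - _).
  rewrite scaler_sumr -big_split/=; apply: eq_bigr => i _.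
  have /(dual_ballE rs)[lg _] : dual_ball X (gf (v i)).
    by have [] := PS _ (Pv i).
  rewrite -[(a *: (S1 : X -> X) + S2) _]/(a *: S1 _ + S2 _) lg mulrDr.
  congr (_ + _).
  by rewrite -[a *: _]/(a * _) -[a *: _]/(a * _) mulrCA.
suff dT : d T = 0 by apply/eqP; rewrite -subr_eq0; apply/eqP.
have dF j : re rs (d (F j)) = 0.
  rewrite /d reB re_sum vE -sumrB big1// => i _.
  by rewrite re_injM tensorF subrr.
have dE ij : d (E ij) = 0.
  apply: (@re_im_unit_inj _ rs).
    by have := dF (ij, false); rewrite /F /un/= scale1r.
  have := dF (ij, true); rewrite /F /un/=.
  by rewrite -[_ *: E ij]addr0 ld (linear_zero ld) addr0.
have [lT _] := bounded_operatorP T.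
have -> : T = \sum_(ij : 'I_n * 'I_n) xi ij.2 (T (e ij.1)) *: E ij.
  apply: operator_ext => x; rewrite operator_sumE.
  rewrite [in LHS](xiE x) (linear_comb _ _ _ lT).
  transitivity (\sum_i \sum_j (xi j (T (e i)) * xi i x) *: e j).
    apply: eq_bigr => i _; rewrite [in LHS](xiE (T (e i))) scaler_sumr.
    by apply: eq_bigr => j _; rewrite scalerA mulrC.
  rewrite pair_bigA/=; apply: eq_bigr => ij _.
  by rewrite -scalerA -EE.
rewrite (linear_comb _ _ _ ld) big1// => ij _.
by rewrite dE scaler0.
Qed.
End DualBallHull.

(** * Extreme points and finite convex combinations *)

(** Arbitrary finite combinations are allowed, so that all terms but one can be grouped into a
    single point. *)
Definition convex_set (K : numFieldType) (V : lmodType K) (C : set V) : Prop :=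
  forall (I : finType) (t : I -> K) (y : I -> V),
    (forall i, 0 <= t i) -> \sum_i t i = 1 -> (forall i, C (y i)) ->
    C (\sum_i t i *: y i).

(** Unless [t i] is 1, grouping the terms other than [i] and dividing by [1 - t i] exhibits a
    combination of [y i] and one more point of [C], to which extremality applies. *)
Lemma extreme_point_comb (K : numFieldType) (V : lmodType K) (C : set V)
    (I : finType) (t : I -> K) (y : I -> V) :
  convex_set C -> extreme_points C (\sum_i t i *: y i) ->
  (forall i, 0 <= t i) -> \sum_i t i = 1 -> (forall i, C (y i)) ->
  forall i, 0 < t i -> y i = \sum_j t j *: y j.
Proof.
move=> convC [_ ext] t0 t1 Cy i ti.
have rest : \sum_(j | j != i) t j = 1 - t i.
  by rewrite -t1 [in RHS](bigD1 i)//= [RHS]addrC addKr.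
have rest0 : 0 <= 1 - t i by rewrite -rest sumr_ge0.
have [ti1|ti1] := eqVneq (t i) 1.
  rewrite (bigD1 i)//= ti1 scale1r big1 ?addr0// => j ji.
  have /eqP : \sum_(j | j != i) t j = 0 by rewrite rest ti1 subrr.
  rewrite psumr_eq0// => /allP/(_ j).
  rewrite mem_index_enum ji => /(_ isT)/eqP ->.
  by rewrite scale0r.
have r_gt0 : 0 < 1 - t i by rewrite lt_neqAle rest0 eq_sym subr_eq0 eq_sym ti1.
pose s j := if j == i then 0 else t j / (1 - t i).
have Cz : C (\sum_j s j *: y j).
  apply: convC => //.
    by move=> j; rewrite /s; case: eqP => // _; rewrite divr_ge0.
  rewrite (bigD1 i)//= /s eqxx add0r.
  rewrite (eq_bigr (fun j => t j / (1 - t i))) => [|j /negPf -> //].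
  by rewrite -mulr_suml rest mulfV// gt_eqF.
have [||yi _] := ext _ _ (t i) (Cy i) Cz ti; [by rewrite -subr_gt0| |exact: yi].
rewrite (bigD1 i)//= [in RHS](bigD1 i)//= /s eqxx scale0r add0r; congr (_ + _).
rewrite scaler_sumr; apply: eq_bigr => j /negPf ->.
by rewrite scalerA mulrC divfK// gt_eqF.
Qed.

Lemma unit_ball_convex (K : numFieldType) (Z : normedModType K) :
  convex_set (unit_ball Z).
Proof.
move=> I t y t0 t1 y1; rewrite /unit_ball/= -t1.
rewrite (le_trans (ler_norm_sum _ _ _))//; apply: ler_sum => i _.
by rewrite normrZ ger0_norm// ler_piMr//; exact: y1.
Qed.

Lemma dual_ball_convex (K : numFieldType) (rs : real_structure K)
    (Z : normedModType K) :
  convex_set (dual_ball Z).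
Proof.
move=> I t f t0 t1 f1.
have fE z : (\sum_i t i *: f i) z = \sum_i t i * f i z by rewrite fct_sumE.
apply/(dual_ballE rs); split => [a u v|z].
  rewrite !fE scaler_sumr -big_split/=; apply: eq_bigr => i _.
  have [lf _] := (dual_ballE rs _).1 (f1 i).
  by rewrite lf mulrDr; congr (_ + _); exact: mulrCA.
rewrite fE (le_trans (ler_norm_sum _ _ _))//.
rewrite -[leRHS]mul1r -t1 mulr_suml; apply: ler_sum => i _.
have [_ fc] := (dual_ballE rs _).1 (f1 i).
by rewrite normrM ger0_norm// ler_wpM2l.
Qed.

(** By the triangle inequality the weighted mean of the two moduli is at least 1, while neither
    exceeds 1. *)
Lemma norm1_convex_comb (K : numFieldType) (a b t : K) :
  `|a| <= 1 -> `|b| <= 1 -> 0 < t -> t < 1 ->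
  `|t * a + (1 - t) * b| = 1 -> `|a| = 1 /\ `|b| = 1.
Proof.
move=> a1 b1 t0 t1 ab.
have t1' : 0 < 1 - t by rewrite subr_gt0.
have le1 : 1 <= t * `|a| + (1 - t) * `|b|.
  rewrite -[leLHS]ab (le_trans (ler_normD _ _))// !normrM.
  by rewrite (gtr0_norm t0) (gtr0_norm t1').
have tt : t + (1 - t) = 1 by rewrite addrC subrK.
split; apply/eqP; move: le1; apply: contraLR => neq.
- have {neq}lt : `|a| < 1 by rewrite lt_neqAle neq.
  rewrite -real_ltNge ?ger0_real ?addr_ge0 ?mulr_ge0// ?ltW//.
  by rewrite -[ltRHS]tt ltr_leD// ?gtr_pMr// ler_piMr// ltW.
- have {neq}lt : `|b| < 1 by rewrite lt_neqAle neq.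
  rewrite -real_ltNge ?ger0_real ?addr_ge0 ?mulr_ge0// ?ltW//.
  by rewrite -[ltRHS]tt ler_ltD// ?gtr_pMr// ler_piMr// ltW.
Qed.

(** * Extreme points of the dual ball: the two inclusions *)

Section ExtremePoints.
Variables (K : numFieldType) (rs : real_structure K) (X : normedModType K).
Variable w_norm : is_norm (@numerical_radius K X).
Hypothesis X_neq0 : exists x : X, x != 0.
Variables (n : nat) (e : 'I_n -> X) (xi : 'I_n -> X -> K^o).
Hypothesis xiE : forall x, x = \sum_i xi i x *: e i.
Hypothesis xi_linear : forall i, linear (xi i).
Hypothesis xi_sum : forall (c : 'I_n -> K) i, xi i (\sum_j c j *: e j) = c i.
Local Notation tens := (tensor w_norm).

Lemma tensor_dual_ball f x : norming_pairs (f, x) ->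
  dual_ball (operator_w w_norm) (tens f x).
Proof.
move=> Sfx; apply/(dual_ballE rs).
have [/(dual_ballE rs)[lf _] _ _] := Sfx; split.
  by move=> a S T; exact: lf.
by move=> T; exact: (numerical_radiusP rs T).1 _ Sfx.
Qed.

(** Evaluation at the operator that sends [z] to [xi i z *: x] gives [xi i y * f x = xi i x * f x];
    cancel [f x]. *)
Lemma tensor_injr (f : X -> K^o) x y :
  linear f -> f x != 0 -> tens f y = tens f x -> y = x.
Proof.
move=> lf fx0 yx; rewrite (xiE y) (xiE x); apply: eq_bigr => i _.
congr (_ *: _).
have [T TE] := coordinate_operator rs xiE xi_linear xi_sum i x.
have := congr1 (fun F => F T) yx; rewrite /tensor !TE !linear_functionalZ//.
exact: mulIf.
Qed.

(** Evaluation at the operator that sends [v] to [f v *: z] gives [f x * g z = f x * f z]; cancel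
    [f x]. *)
Lemma tensor_injl (f g : X -> K^o) x :
  dual_ball X f -> linear g -> f x != 0 -> tens g x = tens f x -> g = f.
Proof.
move=> /(dual_ballE rs)[lf fc] lg fx0 gf; apply: funext => z.
have [|T TE] := @rank_one_operator _ _ f z lf.
  by exists 1 => v; rewrite mul1r.
have := congr1 (fun F => F T) gf; rewrite /tensor !TE !linear_functionalZ//.
exact: mulfI.
Qed.

(** By extremality [f] equals any tensor of positive weight in its hull representation. If [g] or
    [x] is decomposed, [norm1_convex_comb] shows that the parts still form norming pairs, so their
    tensors lie in the ball and coincide with [f]; injectivity of the tensor in each factor
    concludes. *)
Lemma extreme_tensor f : extreme_points (dual_ball (operator_w w_norm)) f ->
  exists g x, [/\ norming_pairs (g, x), extreme_points (dual_ball X) g,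
    extreme_points (unit_ball X) x & f = tens g x].
Proof.
move=> /[dup] fext [fball f_ext].
have [m [t [p [t0 t1 Sp fE]]]] :=
  dual_ball_hull rs X_neq0 xiE xi_linear xi_sum fball.
have fsum : f = \sum_i t i *: tens (p i).1 (p i).2.
  by apply: funext => T; rewrite fE fct_sumE.
have [i ti] : exists i, 0 < t i.
  apply: contrapT => H; have := oner_neq0 K; rewrite -t1 big1 ?eqxx// => i _.
  apply/eqP; apply: contrapT => /negP ti; apply: H; exists i.
  by rewrite lt_neqAle eq_sym ti t0.
have ball_p j : dual_ball (operator_w w_norm) (tens (p j).1 (p j).2).
  by apply: tensor_dual_ball; rewrite -surjective_pairing.
have fi : f = tens (p i).1 (p i).2.
  have fext' := fext; rewrite fsum in fext'.
  have := extreme_point_comb (@dual_ball_convex _ rs _) fext' t0 t1 ball_p ti.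
  by rewrite -fsum => ->.
have := Sp i; case: (p i) fi => g x /= {fE fsum} -> in f_ext * => Sgx.
have [/= gball x1 gx1] := Sgx; have [lg gc] := (dual_ballE rs _).1 gball.
have gx0 : g x != 0 by rewrite -normr_eq0 gx1 oner_eq0.
exists g, x; split => //.
- split => // g1 g2 s g1ball g2ball s0 s1 gE.
  have [lg1 g1c] := (dual_ballE rs _).1 g1ball.
  have [lg2 g2c] := (dual_ballE rs _).1 g2ball.
  have [g1x g2x] : `|g1 x| = 1 /\ `|g2 x| = 1.
    apply: (@norm1_convex_comb _ _ _ s) => //.
    + exact: le_trans (g1c x) x1.
    + exact: le_trans (g2c x) x1.
    + by rewrite -[RHS]gx1 gE.
  have [| | | | |H1 H2] := f_ext (tens g1 x) (tens g2 x) s; rewrite ?s0 ?s1//.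
  + exact: tensor_dual_ball.
  + exact: tensor_dual_ball.
  + by apply: funext => T; rewrite /tensor gE.
  by split; apply: (@tensor_injl g _ x).
- split => // y z s y1 z1 s0 s1 xE.
  have [gy gz] : `|g y| = 1 /\ `|g z| = 1.
    apply: (@norm1_convex_comb _ _ _ s) => //.
    + exact: le_trans (gc y) y1.
    + exact: le_trans (gc z) z1.
    + by rewrite -[RHS]gx1 [in RHS]xE lg (linear_functionalZ _ _ lg).
  have [| | | | |H1 H2] := f_ext (tens g y) (tens g z) s; rewrite ?s0 ?s1//.
  + exact: tensor_dual_ball.
  + exact: tensor_dual_ball.
  + apply: funext => T; rewrite /tensor [in LHS]xE.
    have [lT _] := bounded_operatorP T.
    by rewrite lT -[(1 - s) *: z]addr0 lT (linear_zero lT) addr0 lg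
      (linear_functionalZ _ _ lg).
  by split; apply: (@tensor_injr g).
Qed.

Lemma extreme_tensor_comb f x (I : finType) (c : I -> K)
    (p : I -> (X -> K^o) * X) :
  extreme_points (dual_ball X) f -> extreme_points (unit_ball X) x ->
  `|f x| = 1 -> (forall i, 0 <= c i) -> \sum_i c i = 1 ->
  (forall i, norming_pairs (p i)) ->
  (forall T : bounded_operator X, f (T x) = \sum_i c i * (p i).1 (T (p i).2)) ->
  forall i, 0 < c i -> forall T : bounded_operator X,
    (p i).1 (T (p i).2) = f (T x).
Proof.
move=> fext xext fx1 c0 c1 Sp fxE i ci T.
have [/(dual_ballE rs)[lf fc] _] := fext.
have [x1 _] := xext.
have fx0 : f x != 0 by rewrite -normr_eq0 fx1 oner_eq0.
have lp j : linear (p j).1 by have [/(dual_ballE rs)[]] := Sp j.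
have pc j z : `|(p j).1 z| <= `|z| by have [/(dual_ballE rs)[_]] := Sp j.
have p1 j : `|(p j).2| <= 1 by have [] := Sp j.
have ninv z : `|(f x)^-1 * z| = `|z| by rewrite normrM normfV fx1 invr1 mul1r.
(* Compare coordinates: for the [k]-th one, evaluate [fxE] at the operator that sends [z] to
   [xi k z *: x]. *)
have xsum : x = \sum_j c j *: (((f x)^-1 * (p j).1 x) *: (p j).2).
  rewrite [LHS]xiE [RHS]xiE; apply: eq_bigr => k _; congr (_ *: _).
  rewrite (linear_comb _ _ _ (xi_linear k)).
  have [S SE] := coordinate_operator rs xiE xi_linear xi_sum k x.
  apply: (mulIf fx0); have := fxE S; rewrite SE linear_functionalZ// => ->.
  rewrite mulr_suml; apply: eq_bigr => j _.
  rewrite SE (linear_functionalZ _ _ (lp j)).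
  rewrite (linear_functionalZ _ _ (xi_linear k)).
  rewrite -[c j *: _]/(c j * _) -mulrA; congr (_ * _).
  by rewrite [RHS]mulrC !mulrA mulfV// mul1r mulrC.
(* Here [fxE] is evaluated at the operator that sends [v] to [f v *: z]. *)
have fsum : f = \sum_j c j *: (((f x)^-1 * f (p j).2) *: (p j).1).
  apply: funext => z; rewrite fct_sumE.
  have [|S SE] := @rank_one_operator _ _ f z lf.
    by exists 1 => v; rewrite mul1r.
  apply: (mulfI fx0); have := fxE S; rewrite SE linear_functionalZ// => ->.
  rewrite mulr_sumr; apply: eq_bigr => j _; rewrite SE linear_functionalZ//.
  rewrite -[RHS]/(f x * (c j * ((f x)^-1 * f (p j).2 * (p j).1 z))).
  by rewrite [RHS]mulrCA -[_ * _ * (p j).1 z]mulrA mulVKf.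
have xi_eq : ((f x)^-1 * (p i).1 x) *: (p i).2 = x.
  rewrite [RHS]xsum; rewrite xsum in xext.
  apply: (extreme_point_comb (@unit_ball_convex _ _) xext) => // j.
  by rewrite /unit_ball/= normrZ ninv mulr_ile1// (le_trans (pc j x)).
have ball_g j : dual_ball X (((f x)^-1 * f (p j).2) *: (p j).1 : X -> K^o).
  apply/(dual_ballE rs); split => [a u v|z].
    rewrite -![(_ *: (p j).1) _]/(_ * (p j).1 _) lp mulrDr; congr (_ + _).
    exact: mulrCA.
  rewrite -[(_ *: (p j).1) _]/(_ * (p j).1 _) normrM ninv -[leRHS]mul1r.
  by rewrite ler_pM// (le_trans (fc _)).
have f_eq : ((f x)^-1 * f (p i).2) *: (p i).1 = f.
  have fext' := fext; rewrite fsum in fext'.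
  have := extreme_point_comb (@dual_ball_convex _ rs X) fext' c0 c1 ball_g ci.
  by rewrite -fsum.
have [lT _] := bounded_operatorP T.
have TxE : T x = ((f x)^-1 * (p i).1 x) *: T (p i).2.
  rewrite -[in LHS]xi_eq -[_ *: (p i).2]addr0 lT (linear_zero lT).
  by rewrite addr0.
have fz z : f z = (f x)^-1 * f (p i).2 * (p i).1 z by rewrite -[in LHS]f_eq.
have fxE' : f x = (f x)^-1 * (p i).1 x * f (p i).2.
  by rewrite -[in LHS]xi_eq linear_functionalZ.
rewrite TxE linear_functionalZ// (fz (T _)) mulrA.
(* By [fxE'] this product is [(f x)^-1 * f x]. *)
suff -> : (f x)^-1 * (p i).1 x * ((f x)^-1 * f (p i).2) = 1 by rewrite mul1r.
by rewrite mulrCA -fxE' mulVf.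
Qed.

(** Both parts [y] and [z] of a decomposition are represented by norming pairs; merged with weights
    [s] and [1 - s], these form one combination to which [extreme_tensor_comb] applies. *)
Lemma tensor_extreme f x :
  extreme_points (dual_ball X) f -> extreme_points (unit_ball X) x ->
  `|f x| = 1 -> extreme_points (dual_ball (operator_w w_norm)) (tens f x).
Proof.
move=> fext xext fx1; split.
  by apply: tensor_dual_ball; split => //=; [case: fext|case: xext].
move=> y z s yball zball s0 s1 yz.
have [m [a [p [a0 a1 Sp yE]]]] :=
  dual_ball_hull rs X_neq0 xiE xi_linear xi_sum yball.
have [k [b [q [b0 b1 Sq zE]]]] :=
  dual_ball_hull rs X_neq0 xiE xi_linear xi_sum zball.
pose c (i : 'I_m + 'I_k) := match i with
  inl i => s * a i | inr j => (1 - s) * b j end.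
pose r (i : 'I_m + 'I_k) := match i with inl i => p i | inr j => q j end.
have s1' : 0 < 1 - s by rewrite subr_gt0.
have c0 i : 0 <= c i by case: i => i; rewrite mulr_ge0// ltW.
have c1 : \sum_i c i = 1.
  by rewrite big_sumType/= -!mulr_sumr a1 b1 !mulr1 addrC subrK.
have Sr i : norming_pairs (r i) by case: i => i; [exact: Sp|exact: Sq].
have fxE (T : bounded_operator X) :
    f (T x) = \sum_i c i * (r i).1 (T (r i).2).
  have := congr1 (fun F => F T) yz; rewrite {1}/tensor => ->.
  rewrite -[LHS]/(s * y T + (1 - s) * z T) yE zE big_sumType/= !mulr_sumr.
  by congr (_ + _); apply: eq_bigr => i _; rewrite mulrA.
have all_eq := extreme_tensor_comb fext xext fx1 c0 c1 Sr fxE.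
split; apply: funext => T.
  rewrite yE /tensor -[RHS]mul1r -a1 mulr_suml; apply: eq_bigr => i _.
  (* Terms of weight 0 are out of reach of [extreme_tensor_comb] but contribute nothing. *)
  have [->|ai] := eqVneq (a i) 0; first by rewrite !mul0r.
  congr (_ * _); apply: (all_eq (inl i)).
  by rewrite /= mulr_gt0// lt_neqAle eq_sym ai a0.
rewrite zE /tensor -[RHS]mul1r -b1 mulr_suml; apply: eq_bigr => i _.
have [->|bi] := eqVneq (b i) 0; first by rewrite !mul0r.
congr (_ * _); apply: (all_eq (inr i)).
by rewrite /= mulr_gt0// lt_neqAle eq_sym bi b0.
Qed.

End ExtremePoints.

Theorem theorem2p16 (K : numFieldType) (hK : real_or_complex K)
  (X : completeNormedModType K) (X_fin : finite_dimensional X)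
  (X_neq0 : exists x : X, x != 0)
  (w_norm : is_norm (@numerical_radius K X)) :
  extreme_points (dual_ball (operator_w w_norm)) =
  [set tensor w_norm p.1 p.2 | p in
    [set p : (X -> K^o) * X | [/\ extreme_points (dual_ball X) p.1,
       extreme_points (unit_ball X) p.2 & `|p.1 p.2| = 1]]].
Proof.
have [rs] := real_or_complex_structure hK.
have [n [e [xi [xiE xi_linear xi_sum]]]] := finite_dimensional_basis X_fin.
apply/seteqP; split => [f fext|_ [[f x] [/= fext xext fx1] <-]].
  have [g [x [[_ _ gx1] gext xext ->]]] :=
    extreme_tensor rs X_neq0 xiE xi_linear xi_sum fext.
  by exists (g, x).
exact: (tensor_extreme rs w_norm X_neq0 xiE xi_linear xi_sum fext xext fx1).
Qed.
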